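(* Let $F:\Omega\times M\to\Omega\times M$ be a random zooming map (with zooming contraction $\alpha$ and $\delta>0$). Suppose there exists a random zooming potential $\phi_0$ which has an equilibrium state that is not a measure of maximal entropy. Then the null potential $\phi\equiv0$ is a random zooming potential, that is, $$\sup_{\nu\in\mathcal{Z}^c}h_\nu(f)<\sup_{\mu\in\mathcal{Z}}h_\mu(f).$$
   Context: **Setting.** $M$ is a connected compact metric space with distance $d$, and $\mathcal{C}^0=\mathcal{C}^0(M,M)$ is the space of continuous maps of $M$. $\Omega$ is a Polish space, $\mathbb{P}$ is a Borel probability measure on $\Omega$, and $T:\Omega\to\Omega$ preserves $\mathbb{P}$. A random transformation is a continuous map $f:\Omega\to\mathcal{C}^0$, $w\mapsto f_w$. It generates the skew-product $F(w,x)=(T(w),f_w(x))$ on $\Omega\times M$, with $F^n(w,x)=(T^n(w),f_w^n(x))$, $f_w^n=f_{T^{n-1}(w)}\circ\cdots\circ f_w$. Each fibre $\{w\}\times M$ is identified with $M$. **Invariant measures.** $\mathcal{M}(F,\Omega\times M)$ is the set of $F$-invariant Borel probability measures $\mu$ on $\Omega\times M$ whose marginal on $\Omega$ is $\mathbb{P}$. For such $\mu$, the sample measures $\mu_w$ are those of the disintegration $d\mu(w,x)=d\mu_w(x)\,d\mathbb{P}(w)$. **Zooming contraction.** A sequence of functions $\alpha_n:[0,+\infty)\to[0,+\infty)$ such that: $\alpha_n(r)<r$ for all $n\in\mathbb{N}$, $r>0$; $\alpha_n(r)<\alpha_n(s)$ whenever $0<r<s$, for all $n$; $\alpha_m\circ\alpha_n(r)\le\alpha_{m+n}(r)$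 for all $r>0$ and $m,n\in\mathbb{N}$; and $\sup_{r\in(0,1)}\sum_{n=1}^\infty\alpha_n(r)<\infty$. **Random zooming times.** Fix a zooming contraction $\alpha=\{\alpha_n\}$ and $\delta>0$. A number $n\in\mathbb{N}$ is an $(\alpha,\delta)$-random zooming time for $(w,x)$ if (i) there is a neighbourhood $V_n(w,x)\subset\{w\}\times M$ of $(w,x)$ which $f_w^n$ sends homeomorphically onto the ball $B_\delta(f_w^n(x))\subset\{T^n(w)\}\times M$; and (ii) $d(f_w^i(y),f_w^i(z))\le\alpha_{n-i}(d(f_w^n(y),f_w^n(z)))$ for all $y,z\in V_n(w,x)$ and all $0\le i\le n-1$. This is required for $\mathbb{P}$-almost every $w$. **Random zooming set, measures and maps.** $\Lambda$ is the set of $(w,x)\in\Omega\times M$ such that $$\limsup_{n\to\infty}\frac1n\#\{0\le j\le n-1\mid j\text{ is an }(\alpha,\delta)\text{-random zooming time for }(w,x)\}>0.$$ A Borel probability measure $\mu$ on $\Omega\times M$ is random zooming if $\mu(\Lambda)=1$. $F$ is a random zooming map (random zooming system) if, for the fixed $\alpha,\delta$ and random zooming times as defined by (i), (ii), there exists a random zooming Borel probability measure. **Potentials.** $\mathbb{L}^1_{\mathbb{P}}(\Omega,C^0(M))$ is the space of measurable $\phi:\Omega\times M\to\mathbb{R}$ such that $\phi_w=\phi(w,\cdot)$ is continuous for all $w$ and $\int_\Omega\|\phi_w\|_\infty\,d\mathbb{P}(w)<\infty$. **Entropy.** For $\mu\in\mathcal{M}(F,\Omega\times M)$ and a finite measurable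 partition $\xi$ of $M$, $$h_\mu(f,\xi)=\lim_{n\to\infty}\frac1n\int_\Omega H_{\mu_w}\Big(\bigvee_{j=0}^{n-1}(f_w^j)^{-1}(\xi)\Big)d\mathbb{P}(w),\qquad H_\nu(\xi)=-\sum_{P\in\xi}\nu(P)\log\nu(P),$$ and $h_\mu(f)=\sup_\xi h_\mu(f,\xi)$ over finite measurable partitions of $M$. **Pressure and equilibrium states.** A set $F_n\subseteq M$ is $(w,n,\varepsilon)$-separated if for any distinct $y,z\in F_n$ there is $0\le j\le n-1$ with $d(f_w^j(y),f_w^j(z))>\varepsilon$. Put $S_n\phi(w,y)=\sum_{j=0}^{n-1}\phi_{T^j(w)}(f_w^j(y))$, $P_f(\phi)(w,n,\varepsilon)=\sup\{\sum_{y\in F_n}e^{S_n\phi(w,y)}: F_n\ (w,n,\varepsilon)\text{-separated}\}$ and $$P_f(\phi)=\lim_{\varepsilon\to0}\limsup_{n\to\infty}\frac1n\int_\Omega\log P_f(\phi)(w,n,\varepsilon)\,d\mathbb{P}(w).$$ An equilibrium state for $\phi$ is a measure $\mu\in\mathcal{M}(F,\Omega\times M)$ with $P_f(\phi)=h_\mu(f)+\int\phi\,d\mu$. A measure of maximal entropy is an equilibrium state for the null potential, i.e. a $\mu\in\mathcal{M}(F,\Omega\times M)$ with $h_\mu(f)=P_f(0)$. **Random zooming potentials.** Let $\mathcal{Z}$ be the set of random zooming measures in $\mathcal{M}(F,\Omega\times M)$, and $\mathcal{Z}^c$ its complement in $\mathcal{M}(F,\Omega\times M)$. A potential $\phi\in\mathbb{L}^1_{\mathbb{P}}(\Omega,C^0(M))$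 is a random zooming potential if $$\sup_{\nu\in\mathcal{Z}^c}\Big\{h_\nu(f)+\int\phi\,d\nu\Big\}<\sup_{\mu\in\mathcal{Z}}\Big\{h_\mu(f)+\int\phi\,d\mu\Big\}.$$ *)

(* Defs.v *)
From HB Require Import structures.
From mathcomp Require Import all_boot all_order all_algebra.
From mathcomp Require Import all_classical all_reals all_analysis.
Set Implicit Arguments.
Unset Strict Implicit.
Unset Printing Implicit Defensive.
Import Order.TTheory GRing.Theory Num.Theory.
Import numFieldNormedType.Exports.
Local Open Scope classical_set_scope.
Local Open Scope ring_scope.

(* Measurable types are pointed in the library, hence a pointed metric space.
   The point only records nonemptiness, which is implied anyway by the
   existence of a probability measure. *)
#[short(type="pmetricType")]
HB.structure Definition PointedMetric (K : numDomainType) :=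
  {M of Metric K M & isPointed M}.

(* [T] with its Borel sigma-algebra.  For [Omega] Polish and [M] compact metric
   both spaces are second countable, so that the product sigma-algebra on
   [borel Omega * borel M] is the Borel sigma-algebra of the product space. *)
Notation borel T := (g_sigma_algebraType (@open T)).

Definition homeomorphism (X Y : topologicalType) (A : set X) (B : set Y)
    (h : X -> Y) : Prop :=
  [/\ set_bij A B h, {within A, continuous h} &
      exists2 g : Y -> X, {within B, continuous g} &
        forall x, A x -> g (h x) = x].

Definition polish_space (R : realType) (T : topologicalType) : Prop :=
  (exists2 D : set T, countable D & dense D) /\
  exists (X : metricType R) (h : T -> X), homeomorphism [set: T] [set: X] h /\
    forall F : set_system X, ProperFilter F -> cauchy F -> exists x : X, F --> x.

Section random_dynamics.
Context {R : realType} {Omega : ptopologicalType} {M : pmetricType R}.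
Variables (P : probability (borel Omega) R) (T : Omega -> Omega)
  (f : Omega -> M -> M).

Definition measure_preserving : Prop :=
  measurable_fun [set: borel Omega] (T : borel Omega -> borel Omega) /\
  forall B : set (borel Omega), measurable B -> P (T @^-1` B) = P B.

(* Continuity of [w |-> f_w] is for the topology of uniform convergence, that
   is, the sup-distance on C^0(M,M). *)
Definition random_transformation : Prop :=
  (forall w, continuous (f w)) /\
  continuous (f : Omega -> {uniform M -> M}).

Definition skew_product (z : Omega * M) : Omega * M := (T z.1, f z.1 z.2).

Fixpoint fiber_iter (n : nat) (w : Omega) (x : M) : M :=
  if n is m.+1 then f (iter m T w) (fiber_iter m w x) else x.

Definition invariant_measures : set (probability (borel Omega * borel M)%type R) :=
  [set mu : probability (borel Omega * borel M)%type R |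
    (forall A : set (borel Omega * borel M), measurable A ->
       mu (skew_product @^-1` A) = mu A) /\
    (forall B : set (borel Omega), measurable B -> mu (fst @^-1` B) = P B)].

Section zooming.
Variables (alpha : nat -> R -> R) (delta : R).

(* A condition at the point [(w, x)]; a P-null set of fibres on which it is not
   required is null for every measure with marginal P. *)
Definition zooming_time (n : nat) (w : Omega) (x : M) : Prop :=
  exists V : set M,
    [/\ nbhs x V,
        homeomorphism V (ball (fiber_iter n w x) delta) (fiber_iter n w) &
        forall y z, V y -> V z -> forall i, (i < n)%N ->
          mdist (fiber_iter i w y) (fiber_iter i w z) <=
          alpha (n - i)%N (mdist (fiber_iter n w y) (fiber_iter n w z))].

Definition zooming_set : set (Omega * M) :=
  [set z | (0 < limn_esup (fun n : nat =>
     (#|[pred j : 'I_n | `[< zooming_time j z.1 z.2 >]]|%:R / n%:R : R)%:E))%E].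

(* mu(Lambda) = 1, expressed as: the complement of Lambda lies in a measurable
   mu-null set (Lambda is not shown to be measurable, and the value of a measure
   on a nonmeasurable set is meaningless). *)
Definition random_zooming_measure
    (mu : probability (borel Omega * borel M)%type R) : Prop :=
  {ae mu, forall z, zooming_set z}.

Definition random_zooming_map : Prop :=
  exists mu : probability (borel Omega * borel M)%type R,
    random_zooming_measure mu.

Definition zooming_measures : set (probability (borel Omega * borel M)%type R) :=
  [set mu | invariant_measures mu /\ random_zooming_measure mu].

Definition nonzooming_measures :
    set (probability (borel Omega * borel M)%type R) :=
  [set mu | invariant_measures mu /\ ~ random_zooming_measure mu].

End zooming.

Definition L1_potential (phi : Omega * M -> R) : Prop :=
  [/\ measurable_fun [set: borel Omega * borel M] phi,
      forall w, continuous (fun x => phi (w, x)) &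
      (\int[P]_w ereal_sup [set `|phi (w, x)|%:E | x in [set: M]] < +oo)%E].

Definition disintegration (mu : probability (borel Omega * borel M)%type R)
    (kappa : R.-pker (borel Omega) ~> (borel M)) : Prop :=
  forall A : set (borel Omega * borel M), measurable A ->
    mu A = (\int[P]_w kappa w (xsection A w))%E.

(* Partitions are indexed families; the empty cells that indexing may introduce
   contribute 0 to the entropy ([ln 0 = 0]). *)
Definition finite_partition (k : nat) (xi : 'I_k -> set (borel M)) : Prop :=
  [/\ forall i, measurable (xi i), trivIset [set: 'I_k] xi &
      \bigcup_i xi i = [set: M]].

Definition partition_entropy (I : finType) (nu : set (borel M) -> \bar R)
    (xi : I -> set (borel M)) : R :=
  - \sum_(i : I) fine (nu (xi i)) * ln (fine (nu (xi i))).

Definition join_partition (k : nat) (xi : 'I_k -> set (borel M)) (n : nat)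
    (w : Omega) (a : {ffun 'I_n -> 'I_k}) : set (borel M) :=
  [set x | forall j : 'I_n, xi (a j) (fiber_iter j w x)].

Definition entropy_wrt (kappa : R.-pker (borel Omega) ~> (borel M)) (k : nat)
    (xi : 'I_k -> set (borel M)) : \bar R :=
  limn (fun n : nat => ((n%:R : R)^-1)%:E *
    \int[P]_w (partition_entropy (kappa w) (@join_partition k xi n w))%:E)%E.

(* The sample measures are determined P-almost everywhere by [mu] and
   [entropy_wrt] depends only on that class, so ranging over all the
   disintegrations of [mu] does not affect the supremum over partitions. *)
Definition metric_entropy (mu : probability (borel Omega * borel M)%type R) :
    \bar R :=
  ereal_sup [set h | exists (kappa : R.-pker (borel Omega) ~> (borel M))
    (k : nat) (xi : 'I_k -> set (borel M)),
    [/\ disintegration mu kappa, finite_partition xi & h = entropy_wrt kappa xi]].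

Definition free_energy (phi : Omega * M -> R)
    (mu : probability (borel Omega * borel M)%type R) : \bar R :=
  (metric_entropy mu + \int[mu]_z (phi z)%:E)%E.

Definition birkhoff_sum (phi : Omega * M -> R) (n : nat) (w : Omega) (y : M) : R :=
  \sum_(j < n) phi (iter j T w, fiber_iter j w y).

Definition fiber_separated (w : Omega) (n : nat) (eps : R) : set (set M) :=
  [set F | forall y z, F y -> F z -> y <> z ->
    exists2 j, (j < n)%N & eps < mdist (fiber_iter j w y) (fiber_iter j w z)].

Definition separated_sum (phi : Omega * M -> R) (w : Omega) (n : nat) (eps : R) :
    \bar R :=
  ereal_sup [set (\esum_(y in F) (expR (birkhoff_sum phi n w y))%:E)%E
            | F in fiber_separated w n eps].

Definition pressure (phi : Omega * M -> R) : \bar R :=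
  lim (limn_esup (fun n : nat => ((n%:R : R)^-1)%:E *
         \int[P]_w lne (separated_sum phi w n eps))%E @[eps --> 0^'+]).

Definition equilibrium_state (phi : Omega * M -> R)
    (mu : probability (borel Omega * borel M)%type R) : Prop :=
  invariant_measures mu /\ pressure phi = free_energy phi mu.

Definition maximal_entropy_measure
    (mu : probability (borel Omega * borel M)%type R) : Prop :=
  invariant_measures mu /\ metric_entropy mu = pressure (cst 0).

Definition random_zooming_potential (alpha : nat -> R -> R) (delta : R)
    (phi : Omega * M -> R) : Prop :=
  L1_potential phi /\
  (ereal_sup [set free_energy phi nu | nu in nonzooming_measures alpha delta] <
   ereal_sup [set free_energy phi mu | mu in zooming_measures alpha delta])%E.

End random_dynamics.

(* Indices start at 1 and only the restriction of [alpha n] to [0, +oo[ is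
   relevant. *)
Definition zooming_contraction (R : realType) (alpha : nat -> R -> R) : Prop :=
  [/\ forall n r, (0 < n)%N -> 0 <= r -> 0 <= alpha n r,
      forall n r, (0 < n)%N -> 0 < r -> alpha n r < r,
      forall n r s, (0 < n)%N -> 0 < r -> r < s -> alpha n r < alpha n s,
      forall m n r, (0 < m)%N -> (0 < n)%N -> 0 < r ->
        alpha m (alpha n r) <= alpha (m + n)%N r &
      (ereal_sup [set \sum_(1 <= n <oo) (alpha n r)%:E
                  | r in [set r : R | (0 < r < 1)%R]] < +oo)%E].

(* Main.v *)
Require Import Defs.
From HB Require Import structures.
From mathcomp Require Import all_boot all_order all_algebra.
From mathcomp Require Import all_classical all_reals all_analysis.
From mathcomp Require Import ring lra measurable_realfun interval_inference.
Set Implicit Arguments.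
Unset Strict Implicit.
Unset Printing Implicit Defensive.
Import Order.TTheory GRing.Theory Num.Theory.
Import numFieldNormedType.Exports.
Local Open Scope classical_set_scope.
Local Open Scope ring_scope.

(** The gap condition that defines a random zooming potential is very strong.
    The set of invariant measures is convex, and a mixture [(1 - r) mu + r nu]
    with [0 < r] is random zooming only if [nu] is.  If [mu] is zooming and [nu]
    is not, all these mixtures are therefore nonzooming, while their free energy
    approaches that of [mu] as [r] tends to 0, because entropy is concave in the
    measure and the integral of the potential is affine
    ([free_energy_le_nonzooming]).  So the free energies of nonzooming measures
    can stay away from those of zooming measures only if there are no nonzooming
    measures at all, or at least none with an entropy other than [-oo], the
    value for measures without disintegration.  The supremum of the entropies of
    nonzooming measures is then [-oo].  On the other side, the gap for the given
    potential exhibits a zooming measure whose free energy, hence whose entropy,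
    is not [-oo].

    The work lies in the concavity of entropy ([metric_entropy_mixture]).  At a
    fixed time it follows from the concavity of [- u ln u]; it passes to the
    limit in time once this limit is known to exist ([cvg_entropy_rate]).  By
    Fekete's lemma this is a consequence of subadditivity, which rests on a
    conditional Jensen inequality ([integral_entropy_term_preimage_le]) as
    the base map need not be invertible.  Measurability of the fibre entropies
    comes from the joint measurability of the skew product
    ([measurable_random_transformation]). *)

(** * Entropy of finite distributions and subadditive sequences *)

Section entropy_function.
Context {R : realType}.
Implicit Types u : R.

(** The summand of the Shannon entropy; it vanishes at 0 because [ln 0 = 0]. *)
Definition entropy_term u : R := - (u * ln u).

Lemma entropy_term_ge0 u : 0 <= u <= 1 -> 0 <= entropy_term u.
Proof.
move=> /andP[u0 u1]; rewrite /entropy_term oppr_ge0 mulr_ge0_le0//.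
exact: ln_le0.
Qed.

(** Concavity in tangent form: the graph lies below its tangent at any
    [0 < c].  The concavity, subadditivity and Jensen inequalities
    below are sums or integrals of it. *)
Lemma entropy_term_tangent u (c : R) : 0 <= u -> 0 < c -> entropy_term u <= - (u * ln c) + c - u.
Proof.
rewrite /entropy_term le_eqVlt => /predU1P[<- c0|u0 c0]; first by lra.
have := @le_ln1Dx R (c / u - 1).
have cu : 0 < c / u by rewrite divr_gt0.
rewrite (_ : 1 + (c / u - 1) = c / u); last by ring.
rewrite (_ : -1 < c / u - 1); last by lra.
move=> /(_ isT).
rewrite ln_div ?posrE// -(ler_pM2l u0) mulrBr mulrBr mulr1.
by rewrite mulrCA divff ?gt_eqF// mulr1; lra.
Qed.

Lemma entropy_term_le1 u : 0 <= u -> entropy_term u <= 1.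
Proof.
by move=> u0; have := entropy_term_tangent u0 (@ltr01 R); rewrite ln1; lra.
Qed.

(** Both summands are bounded by their tangents at the mixed point, whose
    weighted sum is the value at that point. *)
Lemma entropy_term_concave (e p q : R) : 0 <= e <= 1 -> 0 <= p -> 0 <= q ->
  (1 - e) * entropy_term p + e * entropy_term q <= entropy_term ((1 - e) * p + e * q).
Proof.
move=> /andP[e0 e1] p0 q0; set r := _ * p + _.
have [r0|r0] := ltP 0 r.
  have hp := ler_wpM2l (x := 1 - e) _ (entropy_term_tangent p0 r0).
  have hq := ler_wpM2l e0 (entropy_term_tangent q0 r0).
  rewrite subr_ge0 e1 in hp.
  apply: (le_trans (lerD (hp isT) hq)).
  by rewrite /entropy_term /r; lra.
have h1 : 0 <= (1 - e) * p by rewrite mulr_ge0 ?subr_ge0.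
have h2 : 0 <= e * q by rewrite mulr_ge0.
have pz : (1 - e) * p = 0 by rewrite /r in r0; lra.
have qz : e * q = 0 by rewrite /r in r0; lra.
by rewrite /r /entropy_term pz qz !mulrN !mulrA pz qz; lra.
Qed.

(** Gibbs' argument: take the tangent of [entropy_term] at the product of the
    two marginal masses of [c]; these products sum to at most 1 because
    [c |-> (a c, b c)] is injective. *)
Lemma entropy_term_subadditive (A B C : finType) (a : C -> A) (b : C -> B) (p : C -> R) :
  (forall c c', a c = a c' -> b c = b c' -> c = c') ->
  (forall c, 0 <= p c) -> \sum_c p c = 1 ->
  \sum_c entropy_term (p c) <=
    \sum_i entropy_term (\sum_(c | a c == i) p c) +
    \sum_j entropy_term (\sum_(c | b c == j) p c).
Proof.
move=> inj p0 p1.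
pose pa i := \sum_(c | a c == i) p c.
pose pb j := \sum_(c | b c == j) p c.
have pa0 i : 0 <= pa i by exact: sumr_ge0.
have pb0 i : 0 <= pb i by exact: sumr_ge0.
have lepa c : p c <= pa (a c).
  by rewrite /pa (bigD1 c)//= lerDl sumr_ge0.
have lepb c : p c <= pb (b c).
  by rewrite /pb (bigD1 c)//= lerDl sumr_ge0.
have pa1 : \sum_i pa i = 1.
  by rewrite -p1 [RHS](partition_big a xpredT).
have pb1 : \sum_i pb i = 1.
  by rewrite -p1 [RHS](partition_big b xpredT).
have pointwise c : entropy_term (p c) <= - (p c * ln (pa (a c))) - p c * ln (pb (b c))
      + pa (a c) * pb (b c) - p c.
  have := p0 c; rewrite le_eqVlt => /predU1P[pc0|pc0].
    by rewrite -pc0 /entropy_term !mul0r; have := mulr_ge0 (pa0 (a c)) (pb0 (b c)); lra.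
  have pac : 0 < pa (a c) by exact: lt_le_trans (lepa c).
  have pbc : 0 < pb (b c) by exact: lt_le_trans (lepb c).
  have := entropy_term_tangent (p0 c) (mulr_gt0 pac pbc).
  by rewrite lnM// mulrDr; lra.
have -> : \sum_i entropy_term (\sum_(c | a c == i) p c) = - \sum_c p c * ln (pa (a c)).
  rewrite [in RHS](partition_big a xpredT)//= -sumrN.
  apply: eq_bigr => i _; rewrite /entropy_term -/(pa i) {1}/pa mulr_suml; congr (- _).
  by apply: eq_bigr => c /eqP ->.
have -> : \sum_i entropy_term (\sum_(c | b c == i) p c) = - \sum_c p c * ln (pb (b c)).
  rewrite [in RHS](partition_big b xpredT)//= -sumrN.
  apply: eq_bigr => i _; rewrite /entropy_term -/(pb i) {1}/pb mulr_suml; congr (- _).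
  by apply: eq_bigr => c /eqP ->.
apply: (le_trans (ler_sum _ (fun c _ => pointwise c))).
rewrite !big_split/= !sumrN p1.
suff : \sum_c pa (a c) * pb (b c) <= 1 by lra.
have -> : 1 = \sum_i \sum_j pa i * pb j.
  by under eq_bigr do rewrite -mulr_sumr pb1 mulr1; rewrite pa1.
rewrite pair_big/=.
have ij : injective (fun c => (a c, b c)).
  by move=> c c' [] /inj; exact.
have <- := big_imset (fun x => pa x.1 * pb x.2) (h := fun c => (a c, b c))
  (A := mem C) (in2W ij).
rewrite [leRHS](bigID [in [set (a c, b c) | c in C]%SET])/=.
by rewrite lerDl sumr_ge0// => i _; rewrite mulr_ge0.
Qed.

End entropy_function.

(** Fekete's lemma: [u n / n] tends to its infimum, by Euclidean division of
    [n] by an almost optimal [m]. *)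
Lemma fekete {R : realType} (u : nat -> R) : (forall n, 0 <= u n) ->
  (forall m n, u (m + n)%N <= u m + u n) ->
  cvgn (fun n => n%:R^-1 * u n).
Proof.
move=> u0 usub.
pose E := [set n%:R^-1 * u n | n in [set n : nat | (0 < n)%N]].
have hE : has_inf E.
  split; first by exists (1%:R^-1 * u 1%N), 1%N.
  by exists 0 => _ [n _ <-]; rewrite mulr_ge0 ?invr_ge0.
have umul q m : u (q * m)%N <= q%:R * u m + u 0%N.
  elim: q => [|q ih]; first by rewrite mul0n mul0r add0r.
  by rewrite mulSn (le_trans (usub _ _))// -natr1; lra.
apply/cvg_ex; exists (inf E).
apply/cvgrPdist_le => e e0.
have [_ [m m0 <-] um] := @inf_adherent _ E (e / 2) (divr_gt0 e0 (ltr0Sn _ _)) hE.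
pose K := \sum_(i < m) u i + u 0%N.
have K0 : 0 <= K by rewrite addr_ge0// sumr_ge0.
near=> n.
have n0 : (0 < n)%N by near: n; exact: nbhs_infty_gt.
have nR : 0 < n%:R :> R by rewrite ltr0n.
have mR : 0 < m%:R :> R by rewrite ltr0n.
have infn : inf E <= n%:R^-1 * u n by apply: ge_inf; [exact: hE.2|exists n].
have un : u n <= n%:R * (m%:R^-1 * u m) + K.
  rewrite {1}(divn_eq n m).
  apply: (le_trans (usub _ _)).
  apply: (le_trans (lerD (umul _ _) (lexx _))).
  have r1 : u (n %% m)%N <= \sum_(i < m) u i.
    rewrite (bigD1 (Ordinal (ltn_pmod n m0)))//= lerDl sumr_ge0//.
  have r2 : (n %/ m)%:R * u m <= n%:R * (m%:R^-1 * u m).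
    rewrite mulrA ler_wpM2r// ler_pdivlMr// -natrM ler_nat.
    exact: leq_trunc_div.
  by rewrite /K; lra.
have Kn : n%:R^-1 * K <= e / 2.
  rewrite mulrC ler_pdivrMr// mulrC -ler_pdivrMr ?divr_gt0//.
  near: n; exact: nbhs_infty_ger.
rewrite ler_distlC; apply/andP; split; first lra.
rewrite -(ler_pM2l nR) mulVKf ?gt_eqF//.
apply: (le_trans un).
move: Kn; rewrite -(ler_pM2l nR) mulVKf ?gt_eqF// => Kn.
have : n%:R * (m%:R^-1 * u m) <= n%:R * (inf E + e / 2) by rewrite ler_pM2l// ltW.
by lra.
Unshelve. all: by end_near. Qed.

(** * Integration along a disintegration *)

Section integral_disintegration.
Local Open Scope ereal_scope.
Context d d' (X : measurableType d) (Y : measurableType d') (R : realType).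
Variables (P : probability X R) (k : R.-pker X ~> Y)
  (mu : {measure set (X * Y) -> \bar R}).
Hypothesis muE : forall A, measurable A -> mu A = \int[P]_x k x (xsection A x).

Lemma measurable_kernel_xsection (A : set (X * Y)) : measurable A ->
  measurable_fun [set: X] (fun x => k x (xsection A x) : \bar R).
Proof.
by move=> mA; apply: measurable_fun_xsection_finite_kernel; rewrite inE.
Qed.

Let integral_indic_xsection (A : set (X * Y)) x : measurable A ->
  \int[k x]_y (\1_A (x, y))%:E = k x (xsection A x).
Proof.
move=> mA; rewrite integral_indic//; last first.
  rewrite (_ : (fun y => _) = xsection A x); first exact: measurable_xsection.
  by rewrite xsectionE.
by rewrite setIT xsectionE.
Qed.

Import HBNNSimple.

Let integral_nnsfun_disintegration (h : {nnsfun X * Y >-> R}) :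
  \int[mu]_z (h z)%:E = \int[P]_x \int[k x]_y (h (x, y))%:E.
Proof.
have mr r : measurable (h @^-1` [set r]) by exact: measurable_funPTI.
under [in LHS]eq_integral do rewrite fimfunE -fsumEFin//.
rewrite ge0_integral_fsum//; last 2 first.
  - by move=> r; exact/measurable_EFinP/measurableT_comp.
  - by move=> r z _; rewrite EFinM nnfun_muleindic_ge0.
transitivity (\int[P]_x \sum_(r \in range h)
    r%:E * k x (xsection (h @^-1` [set r]) x)).
  rewrite ge0_integral_fsum//; last 2 first.
  - by move=> r; apply: measurable_funeM; exact: measurable_kernel_xsection.
  - move=> r x _; have [r0|r0] := leP 0%R r; first by rewrite mule_ge0.
    by rewrite preimage_nnfun0// xsection0 measure0 mule0.
  apply: eq_fsbigr => r _.
  rewrite (integralZl_indic _ (fun r => h @^-1` [set r]))//; last first.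
    exact: preimage_nnfun0.
  rewrite integral_indic// setIT muE//.
  have [r0|r0] := leP 0%R r.
    by rewrite ge0_integralZl//; exact: measurable_kernel_xsection.
  rewrite preimage_nnfun0// !integral0_eq ?mule0// => x _;
    by rewrite xsection0 measure0 ?mule0.
apply: eq_integral => x _.
under [in RHS]eq_integral do rewrite fimfunE -fsumEFin//.
have mi r : measurable_fun [set: Y] (fun y => (\1_(h @^-1` [set r]) (x, y) : R)).
  apply: (measurable_fun_pair2 (f := fun z => (\1_(h @^-1` [set r]) z : R))); exact: measurable_indic.
rewrite ge0_integral_fsum//; last 2 first.
  - by move=> r; exact/measurable_EFinP/measurable_funM.
  - by move=> r y _; rewrite EFinM nnfun_muleindic_ge0.
apply: eq_fsbigr => r _.
under eq_integral do rewrite EFinM.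
have [r0|r0] := leP 0%R r.
  by rewrite ge0_integralZl ?integral_indic_xsection//; exact/measurable_EFinP.
rewrite preimage_nnfun0// xsection0 measure0 mule0 integral0_eq// => y _.
by rewrite indic0 mule0.
Qed.

(** The defining identity of a disintegration extends from measurable sets to
    nonnegative functions by monotone approximation with simple functions. *)
Lemma ge0_integral_disintegration (f : X * Y -> \bar R) :
  (forall z, 0 <= f z) -> measurable_fun [set: X * Y] f ->
  \int[mu]_z f z = \int[P]_x \int[k x]_y f (x, y).
Proof.
move=> f0 mf; pose f_ := nnsfun_approx measurableT mf.
have ndf_ z : nondecreasing_seq (fun n => (f_ n z)%:E).
  by move=> a b ab; rewrite lee_fin; exact/lefP/nd_nnsfun_approx.
have limf_ z : limn (fun n => (f_ n z)%:E) = f z.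
  by apply/cvg_lim => //; exact: cvg_nnsfun_approx.
have mf_ n x : measurable_fun [set: Y] (fun y => (f_ n (x, y))%:E).
  by apply: (measurable_fun_pair2 (f := fun z => (f_ n z)%:E)); exact/measurable_EFinP.
transitivity (limn (fun n => \int[mu]_z (f_ n z)%:E)).
  rewrite -monotone_convergence//; last 2 first.
  - by move=> n; exact/measurable_EFinP.
  - by move=> n z _; rewrite lee_fin.
  by apply: eq_integral => z _; rewrite limf_.
under eq_fun do rewrite integral_nnsfun_disintegration.
rewrite -monotone_convergence//; last 3 first.
- move=> n; apply: (measurable_fun_integral_finite_kernel (fun z => (f_ n z)%:E) k).
  + by move=> z; rewrite lee_fin.
  + exact/measurable_EFinP.
- by move=> n x _; apply: integral_ge0 => y _; rewrite lee_fin.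
- move=> x _ a b ab; apply: ge0_le_integral => //.
  + by move=> y _; rewrite lee_fin.
  + by move=> y _; exact: ndf_.
apply: eq_integral => x _; rewrite -monotone_convergence//; last first.
  by move=> n y _; rewrite lee_fin.
by apply: eq_integral => y _; rewrite limf_.
Qed.

End integral_disintegration.

Section pker_xsection.
Context d d' (X : measurableType d) (Y : measurableType d') (R : realType).
Variable k : R.-pker X ~> Y.

Lemma pker_xsection_bounds (A : set (X * Y)) x : measurable A ->
  (0 <= k x (xsection A x) <= 1)%E.
Proof.
move=> mA; rewrite measure_ge0/= -(@prob_kernel _ _ _ _ _ k x) le_measure ?inE//.
exact: measurable_xsection.
Qed.

Lemma pker_xsection_fineK (A : set (X * Y)) x : measurable A ->
  (fine (k x (xsection A x)))%:E = k x (xsection A x).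
Proof.
move=> mA; have /andP[h0 h1] := pker_xsection_bounds x mA.
by rewrite fineK// ge0_fin_numE// (le_lt_trans h1) ?ltry.
Qed.

End pker_xsection.

(** * Conditional Jensen inequality *)

Lemma measurable_entropy_term (R : realType) : measurable_fun [set: R] (@entropy_term R).
Proof.
by apply: measurableT_comp => //; apply: measurable_funM => //; exact: measurable_ln.
Qed.

Section jensen.
Local Open Scope ereal_scope.
Context d d' (X : measurableType d) (Y : measurableType d') (R : realType).
Variables (P : probability X R) (k : R.-pker X ~> Y)
  (mu : {measure set (X * Y) -> \bar R}).
Hypothesis muE : forall A, measurable A -> mu A = \int[P]_x k x (xsection A x).
Variables (S : X -> X) (G : X * Y -> X * Y).
Hypotheses (mS : measurable_fun [set: X] S)
  (mG : measurable_fun [set: X * Y] G) (SG : forall z, (G z).1 = S z.1)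
  (muG : forall A, measurable A -> mu (G @^-1` A) = mu A).
Implicit Types (A : set (X * Y)) (b : X -> \bar R).

Let measurable_G A : measurable A -> measurable (G @^-1` A).
Proof. by move=> mA; rewrite -[X in measurable X]setTI; exact: mG. Qed.

Lemma integral_mul_xsection b A : (forall x, 0 <= b x) ->
  measurable_fun [set: X] b -> measurable A ->
  \int[P]_x (b x * k x (xsection A x)) = \int[mu]_z (b z.1 * (\1_A z)%:E).
Proof.
move=> b0 mb mA.
rewrite (ge0_integral_disintegration muE)//; last 2 first.
- by move=> z; rewrite mule_ge0// lee_fin.
- apply: emeasurable_funM; first exact: measurableT_comp.
  exact/measurable_EFinP/measurable_indic.
apply: eq_integral => x _ /=; rewrite ge0_integralZl//; last first.
  apply/measurable_EFinP.
  by apply: (measurable_fun_pair2 (f := fun z => (\1_A z : R))); exact: measurable_indic.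
congr (_ * _); rewrite integral_indic//; last first.
  rewrite (_ : (fun y => _) = xsection A x); first exact: measurable_xsection.
  by rewrite xsectionE.
by rewrite setIT xsectionE.
Qed.

(** Invariance of [mu] says that [x |-> k (S x) (A_(S x))] is the conditional
    expectation of [x |-> k x ((G^-1 A)_x)] given the preimages under [S] of
    the measurable sets; here it is tested against functions of [S x]. *)
Lemma integral_mul_xsection_invariant b A : (forall x, 0 <= b x) ->
  measurable_fun [set: X] b -> measurable A ->
  \int[P]_x (b (S x) * k x (xsection (G @^-1` A) x)) =
  \int[P]_x (b x * k x (xsection A x)).
Proof.
move=> b0 mb mA; rewrite (integral_mul_xsection (b := b \o S))//; last 3 first.
- by move=> x; exact: b0.
- exact: measurableT_comp.
- exact: measurable_G.
rewrite integral_mul_xsection//.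
pose g z := b z.1 * (\1_A z)%:E.
have mg : measurable_fun [set: X * Y] g.
  apply: emeasurable_funM; first exact: measurableT_comp.
  exact/measurable_EFinP/measurable_indic.
transitivity (\int[mu]_(z in G @^-1` setT) (g \o G) z).
  rewrite preimage_setT; apply: eq_integral => z _.
  by rewrite /g /= SG.
rewrite -ge0_integral_pushforward//.
  by apply: eq_measure_integral => B mB _; rewrite -muG.
by move=> z _; rewrite mule_ge0// lee_fin.
Qed.

(** Conditional Jensen inequality for the concave function [entropy_term].  As
    [S] need not be invertible, [G] need not carry the fibre measures to one
    another, and only this inequality between averages is available.  Integrate
    the tangent inequality at [c (S x)], where [c] is the fibre mass of [A],
    moved away from 0 by [h] and rescaled so that [c <= 1] and [- ln c >= 0]. *)
Lemma integral_entropy_term_preimage_le A : measurable A ->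
  \int[P]_x (entropy_term (fine (k x (xsection (G @^-1` A) x))))%:E <=
  \int[P]_x (entropy_term (fine (k x (xsection A x))))%:E.
Proof.
move=> mA; have mGA := measurable_G mA.
pose u x := fine (k x (xsection (G @^-1` A) x)).
pose v x := fine (k x (xsection A x)).
have uE x : (u x)%:E = k x (xsection (G @^-1` A) x) by exact: pker_xsection_fineK.
have vE x : (v x)%:E = k x (xsection A x) by exact: pker_xsection_fineK.
have u01 x : (0 <= u x <= 1)%R by rewrite -!lee_fin uE pker_xsection_bounds.
have v01 x : (0 <= v x <= 1)%R by rewrite -!lee_fin vE pker_xsection_bounds.
have mu' : measurable_fun [set: X] u.
  apply/measurable_EFinP; rewrite (_ : EFin \o u = fun x => k x (xsection (G @^-1` A) x)).
    exact: measurable_kernel_xsection.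
  by apply/funext => x; exact: uE.
have mv' : measurable_fun [set: X] v.
  apply/measurable_EFinP; rewrite (_ : EFin \o v = fun x => k x (xsection A x)).
    exact: measurable_kernel_xsection.
  by apply/funext => x; exact: vE.
have meta (w : X -> R) : measurable_fun [set: X] w ->
    measurable_fun [set: X] (fun x => (entropy_term (w x))%:E).
  move=> mw; apply/measurable_EFinP; apply: measurableT_comp => //.
  exact: measurable_entropy_term.
apply/lee_addgt0Pr => e e0; rewrite -/u -/v.
pose h := (e / 2)%R.
have h0 : (0 < h)%R by rewrite divr_gt0.
pose c x := ((v x + h) / (1 + h))%R.
have c0 x : (0 < c x)%R.
  by have /andP[v0 _] := v01 x; rewrite divr_gt0//; lra.
have c1 x : (c x <= 1)%R.
  by have /andP[v0 v1] := v01 x; rewrite ler_pdivrMr; lra.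
pose b x := (- ln (c x))%R.
have b0 x : (0 <= b x)%R by rewrite oppr_ge0 ln_le0.
have mc : measurable_fun [set: X] c.
  by apply: measurable_funM => //; apply: measurable_funD.
have mb : measurable_fun [set: X] b.
  by apply: measurableT_comp => //; apply: measurableT_comp mc => //; exact: measurable_ln.
have pmul (b' : X -> R) : (forall x, 0 <= b' x)%R -> measurable_fun [set: X] b' ->
   \int[P]_x (b' (S x) * u x)%:E = \int[P]_x (b' x * v x)%:E.
  move=> b'0 mb'; transitivity
    (\int[P]_x ((b' (S x))%:E * k x (xsection (G @^-1` A) x))).
    by apply: eq_integral => x _; rewrite EFinM uE.
  rewrite (@integral_mul_xsection_invariant (EFin \o b'))//; last exact/measurable_EFinP.
  by apply: eq_integral => x _; rewrite EFinM vE.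
have xsT x : xsection setT x = [set: Y] by rewrite xsectionE preimage_setT.
have pS (b' : X -> R) : (forall x, 0 <= b' x)%R -> measurable_fun [set: X] b' ->
   \int[P]_x (b' (S x))%:E = \int[P]_x (b' x)%:E.
  move=> b'0 mb'; transitivity
    (\int[P]_x ((b' (S x))%:E * k x (xsection (G @^-1` setT) x))).
    by apply: eq_integral => x _; rewrite preimage_setT xsT prob_kernel mule1.
  rewrite (@integral_mul_xsection_invariant (EFin \o b'))//; last exact/measurable_EFinP.
  by apply: eq_integral => x _; rewrite xsT prob_kernel mule1.
have uv : \int[P]_x (u x)%:E = \int[P]_x (v x)%:E.
  have := @pmul (cst 1%R) (fun=> ler01) (measurable_cst _).
  by under eq_integral do rewrite mul1r; under [in RHS]eq_integral do rewrite mul1r.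
have vfin : \int[P]_x (v x)%:E \is a fin_num.
  rewrite ge0_fin_numE; last first.
    by apply: integral_ge0 => x _; rewrite lee_fin; case/andP: (v01 x).
  apply: (@le_lt_trans _ _ (\int[P]_x (cst 1 x))); last first.
    by rewrite integral_cst// mul1e [X in X < _](@probability_setT _ _ _ P) ltry.
  apply: ge0_le_integral => //.
  - by move=> x _; rewrite lee_fin; case/andP: (v01 x).
  - exact/measurable_EFinP.
  - by move=> x _; rewrite lee_fin; case/andP: (v01 x).
(* The tangent inequality at [c (S x)], integrated. *)
have step1 : \int[P]_x (entropy_term (u x))%:E + \int[P]_x (u x)%:E <=
    \int[P]_x (b (S x) * u x)%:E + \int[P]_x (c (S x))%:E.
  rewrite -!ge0_integralD//.
  - apply: ge0_le_integral => //.
    + move=> x _; rewrite -EFinD lee_fin addr_ge0// ?entropy_term_ge0//.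
      by case/andP: (u01 x).
    + by apply: emeasurable_funD; [exact: meta|exact/measurable_EFinP].
    + apply: emeasurable_funD; apply/measurable_EFinP.
        by apply: measurable_funM => //; exact: measurableT_comp.
      exact: measurableT_comp.
    + move=> x _; rewrite -!EFinD lee_fin.
      have /andP[u0 _] := u01 x.
      by have := entropy_term_tangent u0 (c0 (S x)); rewrite /b; lra.
  - by move=> x _; rewrite lee_fin mulr_ge0//; case/andP: (u01 x).
  - by apply/measurable_EFinP; apply: measurable_funM => //; exact: measurableT_comp.
  - by move=> x _; rewrite lee_fin ltW.
  - by apply/measurable_EFinP; exact: measurableT_comp.
  - by move=> x _; rewrite lee_fin entropy_term_ge0.
  - exact: meta.
  - by move=> x _; rewrite lee_fin; case/andP: (u01 x).
  - exact/measurable_EFinP.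
(* Replacing [c] by [v] costs at most [2 * h = e]. *)
have step2 : \int[P]_x (b x * v x)%:E + \int[P]_x (c x)%:E <=
    \int[P]_x (entropy_term (v x))%:E + \int[P]_x (v x)%:E + \int[P]_x (cst e%:E x).
  rewrite -!ge0_integralD//.
  - apply: ge0_le_integral => //.
    + move=> x _; rewrite -EFinD lee_fin addr_ge0//; last exact: ltW.
      by rewrite mulr_ge0//; case/andP: (v01 x).
    + by apply: emeasurable_funD; apply/measurable_EFinP => //; exact: measurable_funM.
    + apply: emeasurable_funD => //.
      by apply: emeasurable_funD; [exact: meta|exact/measurable_EFinP].
    + move=> x _; rewrite -!EFinD lee_fin.
      have /andP[v0 v1] := v01 x.
      have hc : (c x <= v x + h)%R.
        by rewrite ler_pdivrMr ?ler_peMr; lra.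
      have hb : (b x * v x <= entropy_term (v x) + h)%R.
        move: v0; rewrite le_eqVlt => /predU1P[<-|v0].
          by rewrite /entropy_term mulr0 mul0r; lra.
        have l1 : (ln (v x) <= ln (v x + h))%R by rewrite ler_ln ?posrE; lra.
        have l2 : (ln (1 + h) <= h)%R by apply: le_ln1Dx; lra.
        rewrite /entropy_term /b /c ln_div ?posrE; [|lra..].
        have := ler_wpM2r (ltW v0) l1.
        have : (ln (1 + h) * v x <= h * 1)%R.
          apply: ler_pM => //; [by apply: ln_ge0; lra|exact: ltW].
        by lra.
      by rewrite /h in hc hb *; lra.
  - by move=> x _; rewrite -EFinD lee_fin addr_ge0 ?entropy_term_ge0//; case/andP: (v01 x).
  - by apply: emeasurable_funD; [exact: meta|exact/measurable_EFinP].
  - by move=> x _; rewrite lee_fin ltW.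
  - by move=> x _; rewrite lee_fin entropy_term_ge0.
  - exact: meta.
  - by move=> x _; rewrite lee_fin; case/andP: (v01 x).
  - exact/measurable_EFinP.
  - by move=> x _; rewrite lee_fin mulr_ge0//; case/andP: (v01 x).
  - by apply/measurable_EFinP; exact: measurable_funM.
  - by move=> x _; rewrite lee_fin ltW.
  - exact/measurable_EFinP.
have := step1; rewrite (pmul b)// (pS c)//; last by move=> x; exact: ltW.
move=> /le_trans /(_ step2); rewrite uv integral_cst// [X in _ * X](@probability_setT _ _ _ P) mule1.
by rewrite addeAC leeD2rE.
Qed.

End jensen.

(** * Convex combinations of probabilities and of kernels *)

Section mixture.
Local Open Scope ereal_scope.
Context d (T : measurableType d) (R : realType).
Variable e : {i01 R}.

Definition mixture (m1 m2 : {measure set T -> \bar R}) :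
    set T -> \bar R :=
  measure_add (mscale ((1 - e%:inum)%:nng)%R m1) (mscale (e%:inum%:nng)%R m2).

Lemma mixtureE m1 m2 A :
  mixture m1 m2 A = (1 - e%:inum)%R%:E * m1 A + e%:inum%:E * m2 A.
Proof. exact: measure_addE. Qed.

HB.instance Definition _ (m1 m2 : {measure set T -> \bar R}) :=
  Measure.copy (mixture m1 m2)
    (measure_add (mscale ((1 - e%:inum)%:nng)%R m1) (mscale (e%:inum%:nng)%R m2)).

Variables m1 m2 : probability T R.

Let mixture_setT : mixture m1 m2 setT = 1.
Proof.
rewrite mixtureE [X in _ * X + _](probability_setT m1).
by rewrite [X in _ + _ * X](probability_setT m2) !mule1 -EFinD subrK.
Qed.

HB.instance Definition _ := Measure_isProbability.Build _ _ _ (mixture m1 m2) mixture_setT.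
End mixture.

Section kmixture.
Local Open Scope ereal_scope.
Context d d' (X : measurableType d) (Y : measurableType d') (R : realType).
Variables (e : {i01 R}) (k1 k2 : R.-pker X ~> Y).

Definition kmixture (x : X) : {measure set Y -> \bar R} :=
  mixture e (k1 x) (k2 x).

Let measurable_kmixture U : measurable U ->
  measurable_fun [set: X] (kmixture ^~ U).
Proof.
move=> mU; rewrite (_ : (fun x => _) =
    fun x => (1 - e%:inum)%R%:E * k1 x U + e%:inum%:E * k2 x U).
  by apply: emeasurable_funD; apply: measurable_funeM; exact: measurable_kernel.
by apply/funext => x; exact: mixtureE.
Qed.

HB.instance Definition _ := isKernel.Build _ _ _ _ _ kmixture measurable_kmixture.

Let kmixture_setT x : kmixture x [set: Y] = 1.
Proof. by rewrite [LHS]mixtureE !prob_kernel !mule1 -EFinD subrK. Qed.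

HB.instance Definition _ := Kernel_isProbability.Build _ _ _ _ _ kmixture kmixture_setT.
End kmixture.

Section integral_mixture.
Local Open Scope ereal_scope.
Context d (T : measurableType d) (R : realType).
Variables (e : {i01 R}) (m1 m2 : {measure set T -> \bar R}).

Lemma ge0_integral_mixture (g : T -> \bar R) : (forall x, 0 <= g x) ->
  measurable_fun [set: T] g ->
  \int[mixture e m1 m2]_x g x =
  (1 - e%:num)%R%:E * \int[m1]_x g x + e%:num%:E * \int[m2]_x g x.
Proof.
move=> g0 mg; rewrite /mixture ge0_integral_measure_add//.
by rewrite !ge0_integral_mscale.
Qed.

Lemma integral_mixture (g : T -> \bar R) :
  m1.-integrable [set: T] g -> m2.-integrable [set: T] g ->
  \int[mixture e m1 m2]_x g x =
  (1 - e%:num)%R%:E * \int[m1]_x g x + e%:num%:E * \int[m2]_x g x.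
Proof.
move=> i1 i2; have mg := measurable_int m1 i1.
have p1 := integrable_pos_fin_num measurableT i1.
have n1 := integrable_neg_fin_num measurableT i1.
have p2 := integrable_pos_fin_num measurableT i2.
have n2 := integrable_neg_fin_num measurableT i2.
rewrite [LHS]integralE [in RHS]integralE [X in _ + _ * X]integralE.
rewrite !ge0_integral_mixture//; [|exact: measurable_funeneg|exact: measurable_funepos].
rewrite -(fineK p1) -(fineK p2) -(fineK n1) -(fineK n2).
by rewrite -!(EFinM, EFinD, EFinN, EFinB); congr EFin; ring.
Qed.

End integral_mixture.

(** * Fibre entropy of finite-valued observables *)

Section fiber_entropy.
Context d d' (X : measurableType d) (Y : measurableType d') (R : realType).
Implicit Types (k : R.-pker X ~> Y).

Definition fiber_mass k (C : finType) (q : X * Y -> C) (x : X) (c : C) : R :=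
  fine (k x (xsection (q @^-1` [set c]) x)).

Definition fiber_entropy k (C : finType) (q : X * Y -> C) (x : X) : R :=
  \sum_c entropy_term (fiber_mass k q x c).

(** Measurability of [q] for the discrete sigma-algebra on [C]; a finite
    measurable partition is handled as such a map. *)
Definition measurable_fibers (C : finType) (q : X * Y -> C) :=
  forall c, measurable (q @^-1` [set c]).

Section one_observable.
Variables (k : R.-pker X ~> Y) (C : finType) (q : X * Y -> C).
Hypothesis mq : measurable_fibers q.

Lemma fiber_massE x c :
  (fiber_mass k q x c)%:E = k x (xsection (q @^-1` [set c]) x).
Proof. exact: pker_xsection_fineK. Qed.

Lemma fiber_mass_ge0 x c : 0 <= fiber_mass k q x c.
Proof. by rewrite fine_ge0. Qed.

Lemma fiber_mass_le1 x c : fiber_mass k q x c <= 1.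
Proof.
by rewrite -lee_fin fiber_massE; case/andP: (pker_xsection_bounds k x (mq c)).
Qed.

Lemma measurable_fiber_mass c : measurable_fun [set: X] (fiber_mass k q ^~ c).
Proof.
apply/measurable_EFinP.
rewrite (_ : EFin \o _ = fun x => k x (xsection (q @^-1` [set c]) x)).
  exact: measurable_kernel_xsection.
by apply/funext => x; exact: fiber_massE.
Qed.

Lemma fiber_entropy_ge0 x : 0 <= fiber_entropy k q x.
Proof.
by apply: sumr_ge0 => c _; rewrite entropy_term_ge0// fiber_mass_ge0 fiber_mass_le1.
Qed.

Lemma fiber_entropy_le x : fiber_entropy k q x <= #|C|%:R.
Proof.
rewrite (le_trans (ler_sum _ (fun c _ => entropy_term_le1 (fiber_mass_ge0 x c))))//.
by rewrite sumr_const.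
Qed.

Lemma measurable_fiber_entropy : measurable_fun [set: X] (fiber_entropy k q).
Proof.
apply: measurable_sum => c; apply: measurableT_comp; first exact: measurable_entropy_term.
exact: measurable_fiber_mass.
Qed.

Lemma measurable_fibers_comp (D : finType) (a : C -> D) :
  measurable_fibers (a \o q).
Proof.
move=> i; rewrite (_ : _ @^-1` _ = \bigcup_(c in a @^-1` [set i]) q @^-1` [set c]).
  by apply: fin_bigcup_measurable => //; exact: finite_finset.
by apply/seteqP; split => [z /= <-|z [c /= <- <-]//]; exists (q z).
Qed.

Lemma fiber_mass_comp (D : finType) (a : C -> D) x i :
  fiber_mass k (a \o q) x i = \sum_(c | a c == i) fiber_mass k q x c.
Proof.
apply: EFin_inj; rewrite -sumEFin /fiber_mass pker_xsection_fineK; last first.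
  exact: measurable_fibers_comp.
under [RHS]eq_bigr do rewrite fiber_massE.
rewrite (_ : xsection _ x =
    \bigcup_(c in a @^-1` [set i]) xsection (q @^-1` [set c]) x).
  rewrite measure_fin_bigcup//=; last 2 first.
  - by move=> c c' _ _ [y [/xsectionP/= <- /xsectionP/= <-]].
  - by move=> c _; apply: measurable_xsection.
  rewrite -[RHS]big_enum [RHS]fsbig_seq ?enum_uniq//; apply: eq_fsbigl.
  by apply/seteqP; split => c /=; rewrite mem_enum => /eqP.
apply/seteqP; split => [y /xsectionP/= <-|y [c /= <-] /xsectionP/= yc].
  by exists (q (x, y)) => //; apply/xsectionP.
by apply/xsectionP; rewrite /= yc.
Qed.

Lemma fiber_mass_sum x : \sum_c fiber_mass k q x c = 1.
Proof.
have := fiber_mass_comp (fun=> tt) x tt.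
rewrite (eq_bigl xpredT)// => <-; rewrite /fiber_mass.
rewrite (_ : _ @^-1` _ = setT); last by apply/seteqP; split.
rewrite (_ : xsection _ x = setT); last by rewrite xsectionE preimage_setT.
by rewrite prob_kernel.
Qed.

(** The masses of [a \o q] and [b \o q] are the marginals of those of [q]. *)
Lemma fiber_entropy_join (D1 D2 : finType) (a : C -> D1) (b : C -> D2) x :
  (forall c c', a c = a c' -> b c = b c' -> c = c') ->
  fiber_entropy k q x <= fiber_entropy k (a \o q) x + fiber_entropy k (b \o q) x.
Proof.
move=> inj; rewrite /fiber_entropy.
under [X in _ <= X + _]eq_bigr do rewrite fiber_mass_comp.
under [X in _ <= _ + X]eq_bigr do rewrite fiber_mass_comp.
by apply: entropy_term_subadditive => //; [exact: fiber_mass_ge0|exact: fiber_mass_sum].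
Qed.

End one_observable.
End fiber_entropy.

(** * Entropy rate of a skew product *)

Section mixed_entropy.
Context d d' (X : measurableType d) (Y : measurableType d') (R : realType).
Variables (e : {i01 R}) (k1 k2 : R.-pker X ~> Y).
Variables (C : finType) (q : X * Y -> C).
Hypothesis mq : measurable_fibers q.

(** Concavity of the entropy in the measure; the contribution of [k2] is
    bounded below by 0. *)
Lemma fiber_entropy_kmixture x :
  (1 - e%:num) * fiber_entropy k1 q x <= fiber_entropy (kmixture e k1 k2) q x.
Proof.
rewrite /fiber_entropy mulr_sumr; apply: ler_sum => c _.
have -> : fiber_mass (kmixture e k1 k2) q x c =
    (1 - e%:num) * fiber_mass k1 q x c + e%:num * fiber_mass k2 q x c.
  apply: EFin_inj; rewrite fiber_massE// [LHS]mixtureE -!fiber_massE//.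
have h1 := fiber_mass_ge0 k1 q x c; have h2 := fiber_mass_ge0 k2 q x c.
apply: le_trans (entropy_term_concave _ h1 h2); last by rewrite ge0 le1.
by rewrite lerDl mulr_ge0// entropy_term_ge0// h2 fiber_mass_le1.
Qed.

End mixed_entropy.

Section entropy_rate.
Local Open Scope ereal_scope.
Context d d' (X : measurableType d) (Y : measurableType d') (R : realType).
Variables (P : probability X R) (k : R.-pker X ~> Y).

Lemma integral_fiber_entropy_bounds (C : finType) (q : X * Y -> C) :
  measurable_fibers q ->
  0 <= \int[P]_x (fiber_entropy k q x)%:E <= (#|C|%:R)%:E.
Proof.
move=> mq; apply/andP; split.
  by apply: integral_ge0 => x _; rewrite lee_fin fiber_entropy_ge0.
apply: (@le_trans _ _ (\int[P]_x (cst (#|C|%:R)%:E x))).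
  apply: ge0_le_integral => //.
  - by move=> x _; rewrite lee_fin fiber_entropy_ge0.
  - exact/measurable_EFinP/measurable_fiber_entropy.
  - by move=> x _; rewrite lee_fin fiber_entropy_le.
by rewrite integral_cst// [X in _ * X](probability_setT P) mule1.
Qed.

Variable (F : X * Y -> X * Y).
Hypothesis mF : measurable_fun [set: X * Y] F.
Variables (C : finType) (q : X * Y -> C).
Hypothesis mq : measurable_fibers q.

Definition itinerary n (z : X * Y) : {ffun 'I_n -> C} :=
  [ffun j : 'I_n => q (iter j F z)].

Lemma measurable_iter n : measurable_fun [set: X * Y] (iter n F).
Proof. by elim: n => [|n ih]; [exact: measurable_id|exact: measurableT_comp]. Qed.

Lemma measurable_fibers_itinerary n : measurable_fibers (itinerary n).
Proof.
move=> c; rewrite (_ : _ @^-1` _ =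
    \bigcap_(j in [set: 'I_n]) (iter j F @^-1` (q @^-1` [set c j]))).
  apply: fin_bigcap_measurable; first exact: finite_finset.
  by move=> j _; rewrite -[X in measurable X]setTI; exact: measurable_iter.
apply/seteqP; split => [z /= <- j _ /=|z zc /=]; first by rewrite ffunE.
by apply/ffunP => j; rewrite ffunE; exact: zc.
Qed.

Let mI := measurable_fibers_itinerary.

Variable mu : {measure set (X * Y) -> \bar R}.
Hypothesis muE : forall A, measurable A -> mu A = \int[P]_x k x (xsection A x).
Hypothesis muF : forall A, measurable A -> mu (F @^-1` A) = mu A.
Variable T : X -> X.
Hypothesis mT : measurable_fun [set: X] T.
Hypothesis FT : forall z, (F z).1 = T z.1.

Lemma integral_fiber_entropy_iter (D : finType) (r : X * Y -> D) m :
  measurable_fibers r ->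
  \int[P]_x (fiber_entropy k (r \o iter m F) x)%:E <=
  \int[P]_x (fiber_entropy k r x)%:E.
Proof.
move=> mr.
have mrF : measurable_fibers (r \o iter m F).
  move=> c; rewrite comp_preimage -[X in measurable X]setTI.
  exact: measurable_iter.
have mfin (r' : X * Y -> D) c : measurable_fibers r' ->
    measurable_fun [set: X] (fun x => (entropy_term (fiber_mass k r' x c))%:E).
  move=> mr'; apply/measurable_EFinP; apply: measurableT_comp.
    exact: measurable_entropy_term.
  exact: measurable_fiber_mass.
have fin0 (r' : X * Y -> D) c x : measurable_fibers r' ->
    0 <= (entropy_term (fiber_mass k r' x c))%:E.
  by move=> mr'; rewrite lee_fin entropy_term_ge0// fiber_mass_ge0 fiber_mass_le1.
rewrite /fiber_entropy.
under eq_integral do rewrite -sumEFin.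
under [leRHS]eq_integral do rewrite -sumEFin.
rewrite !ge0_integral_sum//; [|by move=> c; exact: mfin|by move=> c x _; exact: fin0
  |by move=> c; exact: mfin|by move=> c x _; exact: fin0].
apply: lee_sum => c _.
have muFm A : measurable A -> mu (iter m F @^-1` A) = mu A.
  elim: m A {mrF} => [//|n ih] A mA.
  rewrite -[RHS]muF// -[RHS]ih//.
  by rewrite -[X in measurable X]setTI; exact: mF.
apply: (integral_entropy_term_preimage_le muE (S := iter m T) _ _ _ muFm) => //.
- elim: m {mrF muFm} => [|n ih]; first exact: measurable_id.
  exact: measurableT_comp.
- exact: measurable_iter.
- by move=> z; elim: m {mrF muFm} => //= n <-; rewrite FT.
Qed.

(** An itinerary of length [m + n] is one of length [m] from [z] followed by
    one of length [n] from [iter m F z]; by conditional Jensen, starting at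
    [iter m F z] instead of [z] does not increase the mean entropy. *)
Lemma integral_fiber_entropy_itinerary_subadditive m n :
  \int[P]_x (fiber_entropy k (itinerary (m + n)) x)%:E <=
  \int[P]_x (fiber_entropy k (itinerary m) x)%:E +
  \int[P]_x (fiber_entropy k (itinerary n) x)%:E.
Proof.
pose a (c : {ffun 'I_(m + n) -> C}) : {ffun 'I_m -> C} := [ffun j : 'I_m => c (lshift n j)].
pose b (c : {ffun 'I_(m + n) -> C}) : {ffun 'I_n -> C} := [ffun j : 'I_n => c (rshift m j)].
have aE : a \o itinerary (m + n) = itinerary m.
  by apply/funext => z; apply/ffunP => j; rewrite !ffunE.
have bE : b \o itinerary (m + n) = itinerary n \o iter m F.
  by apply/funext => z; apply/ffunP => j; rewrite !ffunE/= addnC iterD.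
apply: (@le_trans _ _ (\int[P]_x (fiber_entropy k (itinerary m) x)%:E +
  \int[P]_x (fiber_entropy k (itinerary n \o iter m F) x)%:E)); last first.
  by rewrite leeD2l// integral_fiber_entropy_iter.
have mb : measurable_fibers (itinerary n \o iter m F).
  by rewrite -bE; exact: measurable_fibers_comp.
rewrite -ge0_integralD//; first last.
- exact/measurable_EFinP/measurable_fiber_entropy.
- by move=> x _; rewrite lee_fin fiber_entropy_ge0.
- exact/measurable_EFinP/measurable_fiber_entropy.
- by move=> x _; rewrite lee_fin fiber_entropy_ge0.
apply: ge0_le_integral => //.
- by move=> x _; rewrite lee_fin fiber_entropy_ge0.
- exact/measurable_EFinP/measurable_fiber_entropy.
- by apply: emeasurable_funD; exact/measurable_EFinP/measurable_fiber_entropy.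
move=> x _; rewrite -EFinD lee_fin -aE -bE.
apply: fiber_entropy_join => // c c' /ffunP ac /ffunP bc; apply/ffunP => j.
case: (splitP j) => i ji.
  have := ac i; rewrite !ffunE (_ : lshift n i = j)//; exact: val_inj.
have := bc i; rewrite !ffunE (_ : rshift m i = j)//; exact: val_inj.
Qed.

(** The limit in the definition of the entropy of a partition exists.  This
    matters because [limn] of a divergent sequence is a default value, for
    which no inequality between entropies would hold. *)
Lemma cvg_entropy_rate :
  cvgn (fun n => (n%:R^-1)%:E *
                 \int[P]_x (fiber_entropy k (itinerary n) x)%:E).
Proof.
pose u n := fine (\int[P]_x (fiber_entropy k (itinerary n) x)%:E).
have uE n : (u n)%:E = \int[P]_x (fiber_entropy k (itinerary n) x)%:E.
  have /andP[h0 h1] := integral_fiber_entropy_bounds (@mI n).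
  by rewrite fineK// ge0_fin_numE// (le_lt_trans h1)// ltry.
under eq_fun do rewrite -uE -EFinM.
have /cvg_ex[l ul] : cvgn (fun n => n%:R^-1 * u n)%R.
  apply: fekete => [n|m n].
    by have /andP[] := integral_fiber_entropy_bounds (@mI n); rewrite -uE lee_fin.
  by rewrite -lee_fin EFinD !uE integral_fiber_entropy_itinerary_subadditive.
by apply/cvg_ex; exists l%:E; apply: cvg_EFin => //; exact: nearW.
Qed.

End entropy_rate.

(** * Joint measurability of random transformations *)

Lemma countable_bigcup_measurable d (T : measurableType d) (I : Type)
    (B : set I) (F : I -> set T) :
  countable B -> (forall i, B i -> measurable (F i)) ->
  measurable (\bigcup_(i in B) F i).
Proof.
move=> /pfcard_geP[->|[g]] mF; first by rewrite bigcup_set0.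
have gB n : B (g n) by rewrite -[X in X _](image_eq g); exists n.
rewrite -[X in bigcup X](image_eq g) bigcup_image.
by apply: bigcupT_measurable => n; exact: mF.
Qed.

Section measurable_skew.
Context {R : realType} {Omega : ptopologicalType} {M : pmetricType R}.
Variables (f : Omega -> M -> M).

(** [f] is jointly continuous, and [M] has a countable base, so that the
    preimage of an open set is a countable union of open rectangles. *)
Lemma measurable_random_transformation : compact [set: M] ->
  random_transformation f ->
  measurable_fun [set: borel Omega * borel M] (fun z => f z.1 z.2 : borel M).
Proof.
move=> cM [fc fu].
have [B cB [oB bB]] := @compact_second_countable R M cM.
apply: (@measurability _ _ (borel Omega * borel M)%type (borel M) setT _
  (@open M) erefl) => _ [U oU <-]; rewrite setTI.
pose O (V : set M) : set Omega := \bigcup_(W in [set W : set Omega | open W /\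
   forall w x, W w -> V x -> U (f w x)]) W.
rewrite (_ : _ @^-1` U = \bigcup_(V in B) (O V `*` V)).
  apply: countable_bigcup_measurable => // V BV.
  apply: measurableX; apply: sub_sigma_algebra.
    by apply: bigcup_open => W [].
  exact: oB.
apply/seteqP; split => [[w x]/= Ufwx|[w x] [V BV [/= [W [oW WU] Ww] Vx]]]; last first.
  exact: WU.
have /nbhs_ballP[e /= e0 eU] : nbhs (f w x) U by exact: open_nbhs_nbhs.
have e20 : 0 < e / 2 by rewrite divr_gt0.
have [V [BV Vx] Vf] : filter_from [set V | B V /\ V x] id
    [set y | ball (f w x) (e / 2) (f w y)].
  by apply: bB; apply: fc; exact: nbhsx_ballx.
exists V => //; split => //=.
have : nbhs w [set w' | forall y, ball (f w y) (e / 2) (f w' y)].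
  apply: (fu w [set h | forall y, ball (f w y) (e / 2) (h y)]).
  apply/uniform_nbhs.
  exists [set xy : M * M | ball xy.1 (e / 2) xy.2]; split.
    exact: (entourage_ball M (PosNum e20)).
  by move=> h /= hy y; exact: hy.
rewrite nbhsE => -[W [oW Ww] Wf]; exists W => //; split => // w' y Ww' Vy.
apply: eU; rewrite [e]splitr; apply: ball_triangle (Vf _ Vy) _.
exact: Wf.
Qed.
End measurable_skew.

(** * Entropy of mixtures of invariant measures *)

(** The skew product, typed so that its measurability refers to the product of
    the Borel sigma-algebras. *)
Definition borel_skew_product {R : realType} {Omega : ptopologicalType}
    {M : pmetricType R} (T : Omega -> Omega) (f : Omega -> M -> M) :
  borel Omega * borel M -> borel Omega * borel M := skew_product T f.

Section partition_coding.
Context {R : realType} {Omega : ptopologicalType} {M : pmetricType R}.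
Variables (P : probability (borel Omega) R) (T : Omega -> Omega)
  (f : Omega -> M -> M).
Hypothesis mF : measurable_fun [set: borel Omega * borel M]
  (borel_skew_product T f).
Hypothesis mT : measurable_fun [set: borel Omega] (T : borel Omega -> borel Omega).

Lemma iter_skew_product n (z : Omega * M) :
  iter n (borel_skew_product T f) z = (iter n T z.1, fiber_iter T f n z.1 z.2).
Proof. by elim: n => [|n ih]; [case: z|rewrite iterS ih]. Qed.

Variables (k : nat) (xi : 'I_k -> set (borel M)).
Hypothesis pxi : finite_partition xi.

Lemma partition_codingP : {code : M -> 'I_k | forall x i, xi i x <-> code x = i}.
Proof.
have [_ txi cxi] := pxi.
have ex x : exists i, xi i x.
  have : [set: M] x by [].
  by rewrite -cxi => -[i _ xix]; exists i.
exists (fun x => sval (cid (ex x))) => x i; case: cid => j /= xj; split=> [xix|<-//].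
by apply: (txi j i) => //; exists x.
Qed.

Definition coding (z : borel Omega * borel M) : 'I_k := sval partition_codingP z.2.

Lemma codingE z i : (coding z = i) <-> xi i z.2.
Proof. by split => /(svalP partition_codingP z.2 i). Qed.

Lemma measurable_fibers_coding : measurable_fibers coding.
Proof.
move=> i; rewrite (_ : _ @^-1` _ = snd @^-1` xi i); last first.
  by apply/seteqP; split => z /= /codingE.
have [mxi _ _] := pxi; rewrite -[X in measurable X]setTI.
exact: measurable_snd.
Qed.

Variable kappa : R.-pker (borel Omega) ~> (borel M).

Lemma partition_entropyE n w :
  partition_entropy (kappa w) (join_partition T f xi (n := n) w) =
  fiber_entropy kappa (itinerary (borel_skew_product T f) coding n) w.
Proof.
rewrite /partition_entropy /fiber_entropy -sumrN; apply: eq_bigr => a _.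
rewrite /entropy_term /fiber_mass (_ : join_partition _ _ _ _ a =
  xsection (itinerary (borel_skew_product T f) coding n @^-1` [set a]) w)//.
apply/seteqP; split => [x xa|x /xsectionP/= xa j].
  apply/xsectionP => /=; apply/ffunP => j; rewrite ffunE iter_skew_product.
  by apply/codingE; exact: xa.
by apply: (codingE (iter j T w, fiber_iter T f j w x) (a j)).1;
  rewrite -xa ffunE iter_skew_product.
Qed.

Lemma entropy_wrtE : entropy_wrt P T f kappa xi =
  limn (fun n => (n%:R^-1)%:E * \int[P]_w
    (fiber_entropy kappa (itinerary (borel_skew_product T f) coding n) w)%:E)%E.
Proof.
rewrite /entropy_wrt; congr (limn _); apply/funext => n; congr (_ * _)%E.
by apply: eq_integral => w _; rewrite partition_entropyE.
Qed.

End partition_coding.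

Section mixtures.
Local Open Scope ereal_scope.
Context {R : realType} {Omega : ptopologicalType} {M : pmetricType R}.
Variables (P : probability (borel Omega) R) (T : Omega -> Omega)
  (f : Omega -> M -> M).
Hypothesis mF : measurable_fun [set: borel Omega * borel M]
  (borel_skew_product T f).
Hypothesis mT : measurable_fun [set: borel Omega] (T : borel Omega -> borel Omega).
Implicit Types (mu nu : probability (borel Omega * borel M)%type R)
  (kappa : R.-pker (borel Omega) ~> (borel M)).
Variable e : {i01 R}.

(** A measure without disintegration has entropy [-oo], the supremum of the
    empty set. *)
Lemma metric_entropy_disintegration mu : metric_entropy P T f mu != -oo ->
  exists kappa, disintegration P mu kappa.
Proof.
move=> hmu; apply: contrapT => /forallNP nok; move/eqP: hmu; apply.
rewrite /metric_entropy (_ : [set _ | _] = set0) ?ereal_sup0//.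
by apply/seteqP; split => // h [kappa [k [xi [/nok]]]].
Qed.

Lemma disintegration_mixture mu nu kappa1 kappa2 :
  disintegration P mu kappa1 -> disintegration P nu kappa2 ->
  disintegration P (mixture e mu nu : probability _ R) (kmixture e kappa1 kappa2).
Proof.
move=> d1 d2 A mA; rewrite [LHS]mixtureE [X in _ * X + _](d1 _ mA) [X in _ + _ * X](d2 _ mA).
have m1 := measurable_kernel_xsection kappa1 mA.
have m2 := measurable_kernel_xsection kappa2 mA.
rewrite -!ge0_integralZl//.
rewrite -ge0_integralD//.
- by apply: eq_integral => w _; rewrite [RHS]mixtureE.
- exact: measurable_funeM.
- exact: measurable_funeM.
Qed.

Lemma invariant_mixture mu nu : invariant_measures P T f mu ->
  invariant_measures P T f nu ->
  invariant_measures P T f (mixture e mu nu : probability _ R).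
Proof.
move=> [i1 m1] [i2 m2]; split => [A mA|B mB]; rewrite [LHS]mixtureE.
  by rewrite [X in _ * X + _](i1 _ mA) [X in _ + _ * X](i2 _ mA) [RHS]mixtureE.
rewrite [X in _ * X + _](m1 _ mB) [X in _ + _ * X](m2 _ mB) -(fineK (fin_num_measure P B mB)) -!EFinM -EFinD.
by congr EFin; ring.
Qed.

(** The inequality at each fixed time passes to the limit because both
    sequences converge. *)
Lemma entropy_wrt_mixture mu nu kappa1 kappa2 (k : nat) (xi : 'I_k -> set (borel M)) :
  invariant_measures P T f mu -> invariant_measures P T f nu ->
  disintegration P mu kappa1 -> disintegration P nu kappa2 ->
  finite_partition xi ->
  (1 - e%:num)%R%:E * entropy_wrt P T f kappa1 xi <=
  entropy_wrt P T f (kmixture e kappa1 kappa2) xi.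
Proof.
move=> i1 i2 d1 d2 pxi; rewrite !(entropy_wrtE _ _ _ pxi).
set F := borel_skew_product T f; set q := coding pxi.
have mq : measurable_fibers q by exact: measurable_fibers_coding.
have c1 := cvg_entropy_rate mF mq d1 i1.1 mT (fun=> erefl).
have c2 := cvg_entropy_rate mF mq (disintegration_mixture d1 d2)
  (invariant_mixture i1 i2).1 mT (fun=> erefl).
have mI n : measurable_fibers (itinerary F q n) by exact: measurable_fibers_itinerary.
rewrite -limeMl//; apply: lee_lim => //; first exact: is_cvgeMl.
apply: nearW => n; rewrite muleCA; apply: lee_wpmul2l.
  by rewrite lee_fin invr_ge0.
rewrite -ge0_integralZl//; last 2 first.
- exact/measurable_EFinP/measurable_fiber_entropy.
- by move=> w _; rewrite lee_fin fiber_entropy_ge0.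
apply: ge0_le_integral => //.
- by move=> w _; rewrite mule_ge0// lee_fin fiber_entropy_ge0.
- by apply: measurable_funeM; exact/measurable_EFinP/measurable_fiber_entropy.
- exact/measurable_EFinP/measurable_fiber_entropy.
- by move=> w _; rewrite -EFinM lee_fin fiber_entropy_kmixture.
Qed.

(** The hypothesis on [nu] provides the disintegration of [nu] from which that
    of the mixture is built. *)
Lemma metric_entropy_mixture mu nu :
  invariant_measures P T f mu -> invariant_measures P T f nu ->
  (e%:num < 1)%R -> metric_entropy P T f nu != -oo ->
  (1 - e%:num)%R%:E * metric_entropy P T f mu <=
  metric_entropy P T f (mixture e mu nu : probability _ R).
Proof.
move=> i1 i2 e1 hnu.
have [kappa2 d2] := metric_entropy_disintegration hnu.
have e1' : (0 < 1 - e%:num)%R by rewrite subr_gt0.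
rewrite -lee_pdivlMl//; apply: ge_ereal_sup => _ [kappa1 [k [xi [d1 pxi ->]]]].
rewrite lee_pdivlMl//; apply: le_trans (entropy_wrt_mixture i1 i2 d1 d2 pxi) _.
apply: ereal_sup_ubound; exists (kmixture e kappa1 kappa2), k, xi.
by split => //; exact: disintegration_mixture.
Qed.

(** Being random zooming is a property of full measure, hence it is lost as
    soon as [nu], without it, enters the mixture with positive weight. *)
Lemma nonzooming_mixture (alpha : nat -> R -> R) (delta : R) mu nu :
  (0 < e%:num)%R ->
  invariant_measures P T f mu -> nonzooming_measures P T f alpha delta nu ->
  nonzooming_measures P T f alpha delta (mixture e mu nu : probability _ R).
Proof.
move=> e0 i1 [i2 nz]; split; first exact: invariant_mixture.
move=> [A [mA A0 nA]]; apply: nz; exists A; split => //.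
move/eqP: A0; rewrite [X in X == _]mixtureE padde_eq0 ?mule_ge0 ?lee_fin ?subr_ge0//.
by move=> /andP[_]; rewrite mule_eq0 eqe gt_eqF//= => /eqP.
Qed.

End mixtures.

Section potential.
Local Open Scope ereal_scope.
Context {R : realType} {Omega : ptopologicalType} {M : pmetricType R}.
Variables (P : probability (borel Omega) R) (phi : Omega * M -> R).
Hypothesis L1 : L1_potential P phi.
Implicit Types (mu nu : probability (borel Omega * borel M)%type R).

(** On each fibre the mean of [`|phi|] is at most its supremum.  The outer
    integrals are compared through their definition as suprema over simple
    functions, which is monotone without measurability of the larger one. *)
Lemma integrable_L1_potential mu (kappa : R.-pker (borel Omega) ~> (borel M)) :
  disintegration P mu kappa ->
  mu.-integrable [set: borel Omega * borel M] (EFin \o phi).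
Proof.
have [mphi _ bphi] := L1.
have mphi' : measurable_fun [set: borel Omega * borel M] (fun z => `|phi z|%:E).
  by apply/measurable_EFinP; exact: measurableT_comp.
move=> d; apply/integrableP; split; first exact/measurable_EFinP.
apply: le_lt_trans bphi.
rewrite (ge0_integral_disintegration d)//.
rewrite !ge0_integralTE; last 2 first.
- move=> w; apply: le_trans (ereal_sup_ubound (ex_intro2 _ _ point I erefl)).
  by rewrite lee_fin.
- by move=> w; apply: integral_ge0.
apply: le_ereal_sup => _ [h /= hle <-]; exists h => //= w.
apply: le_trans (hle w) _.
set s := ereal_sup _.
apply: (@le_trans _ _ (\int[kappa w]_y (cst s y))).
  apply: ge0_le_integral => //.
  - exact: (measurable_fun_pair2 w mphi').
  - by move=> y _; apply: ereal_sup_ubound; exists y.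
by rewrite integral_cst// [X in _ * X](prob_kernel w) mule1.
Qed.

End potential.

(** * Absence of a gap *)

Section gap.
Local Open Scope ereal_scope.
Context {R : realType} {Omega : ptopologicalType} {M : pmetricType R}.
Variables (P : probability (borel Omega) R) (T : Omega -> Omega)
  (f : Omega -> M -> M).
Hypothesis mF : measurable_fun [set: borel Omega * borel M]
  (borel_skew_product T f).
Hypothesis mT : measurable_fun [set: borel Omega] (T : borel Omega -> borel Omega).
Implicit Types (mu nu : probability (borel Omega * borel M)%type R).

Lemma free_energy_cst0 mu : free_energy P T f (cst 0%R) mu = metric_entropy P T f mu.
Proof. by rewrite /free_energy integral0 adde0. Qed.

Variables (alpha : nat -> R -> R) (delta : R).

(** One nonzooming measure [nu] of entropy other than [-oo] forbids any gap:
    the mixtures [(1 - r) mu + r nu] are nonzooming, and their free energy is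
    at least a quantity that tends to the free energy of [mu] as [r --> 0]. *)
Lemma free_energy_le_nonzooming (phi : Omega * M -> R) mu nu :
  L1_potential P phi -> invariant_measures P T f mu ->
  metric_entropy P T f mu != -oo ->
  nonzooming_measures P T f alpha delta nu -> metric_entropy P T f nu != -oo ->
  free_energy P T f phi mu <=
  ereal_sup [set free_energy P T f phi nu | nu in nonzooming_measures P T f alpha delta].
Proof.
move=> L1 imu hmu znu hnu; set s := ereal_sup _.
have [kmu dmu] := metric_entropy_disintegration hmu.
have [knu dnu] := metric_entropy_disintegration hnu.
have Imu := integrable_L1_potential L1 dmu.
have Inu := integrable_L1_potential L1 dnu.
have := integrable_fin_num measurableT Imu.
have := integrable_fin_num measurableT Inu.
rewrite /free_energy; set I := \int[mu]_z _; set J := \int[nu]_z _ => Jfin Ifin.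
have bound (r : R) : (0 < r < 1)%R ->
    (1 - r)%R%:E * metric_entropy P T f mu +
    ((1 - r) * fine I + r * fine J)%R%:E <= s.
  move=> /andP[r0 r1].
  have [e er] : exists e : {i01 R}, e%:num = r.
    by exists (Itv01 (ltW r0) (ltW r1)).
  rewrite -{}er in r0 r1 *.
  have : free_energy P T f phi (mixture e mu nu : probability _ R) <= s.
    apply: ereal_sup_ubound; exists (mixture e mu nu : probability _ R) => //.
    exact: nonzooming_mixture.
  apply: le_trans.
  rewrite /free_energy [X in _ <= _ + X]integral_mixture//.
  rewrite [((1 - e%:num) * fine I + _)%R%:E]EFinD !EFinM !fineK// leeD2r//.
  exact: metric_entropy_mixture znu.1 r1 hnu.
move: hmu bound; case: (metric_entropy P T f mu) => [h| |]// _ bound.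
- rewrite -(fineK Ifin) -EFinD.
  case: s bound => [s| |] bound; rewrite ?leey//; last first.
    have h12 : (0 < (1 / 2 : R) < 1)%R by lra.
    have := bound _ h12.
    by rewrite -EFinM -EFinD leeNy_eq.
  rewrite lee_fin; apply: contrapT => /negP; rewrite -ltNge => lt.
  (* For this [e], [e * K <= D / 2], while [bound] yields [D <= e * K]. *)
  pose D := (h + fine I - s)%R; pose K := (h + fine I - fine J)%R.
  have D0 : (0 < D)%R by rewrite /D; lra.
  have K0 : (0 <= `|K|)%R by [].
  pose e := (D / (2 * (`|K| + D)))%R.
  have d0 : (0 < 2 * (`|K| + D))%R by lra.
  have e0 : (0 < e)%R by rewrite divr_gt0.
  have e1 : (e < 1)%R by rewrite ltr_pdivrMr//; lra.
  have := bound e.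
  rewrite e0 e1 => /(_ isT); rewrite -EFinM -EFinD lee_fin => b.
  have : (D <= e * K)%R by rewrite /D /K; lra.
  rewrite leNgt => /negP; apply.
  have : (e * K <= e * `|K|)%R by rewrite ler_pM2l// ler_norm.
  have : (e * (2 * (`|K| + D)) = D)%R by rewrite /e divfK// gt_eqF.
  have := mulr_gt0 e0 D0.
  by lra.
- have h12 : (0 < (1 / 2 : R) < 1)%R by lra.
  have := bound _ h12.
  by rewrite gt0_muley ?lte_fin//=; [rewrite addye// leye_eq => /eqP ->; rewrite leey|lra].
Qed.

End gap.

Lemma L1_potential_cst0 {R : realType} {Omega : ptopologicalType}
    {M : pmetricType R} (P : probability (borel Omega) R) :
  L1_potential P (cst 0 : Omega * M -> R).
Proof.
split; [exact: measurable_cst|by move=> w; exact: cst_continuous|].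
rewrite (eq_integral (cst 0%E)) ?integral0// => w _.
rewrite (_ : [set _ | _ in _] = [set 0%E]) ?ereal_sup1//.
apply/seteqP; split => [_ [x _ <-]|_ ->]; first by rewrite /= normr0.
by exists point => //=; rewrite normr0.
Qed.

Theorem mainTheorem3 (R : realType) (Omega : ptopologicalType)
    (M : pmetricType R)
    (hOmega : polish_space R Omega)
    (hMcompact : compact [set: M]) (hMconnected : connected [set: M])
    (P : probability (borel Omega) R) (T : Omega -> Omega)
    (f : Omega -> M -> M)
    (hT : measure_preserving P T) (hf : random_transformation f)
    (alpha : nat -> R -> R) (halpha : zooming_contraction alpha)
    (delta : R) (hdelta : 0 < delta)
    (hF : random_zooming_map T f alpha delta)
    (hphi : exists phi0 : Omega * M -> R,
       random_zooming_potential P T f alpha delta phi0 /\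
       exists2 mu0 : probability (borel Omega * borel M)%type R,
         equilibrium_state P T f phi0 mu0 &
         ~ maximal_entropy_measure P T f mu0) :
  random_zooming_potential P T f alpha delta (cst 0) /\
  (ereal_sup [set metric_entropy P T f nu
             | nu in nonzooming_measures P T f alpha delta] <
   ereal_sup [set metric_entropy P T f mu
             | mu in zooming_measures P T f alpha delta])%E.
Proof.
have mT : measurable_fun [set: borel Omega] (T : borel Omega -> borel Omega).
  exact: hT.1.
have mF : measurable_fun [set: borel Omega * borel M] (borel_skew_product T f).
  apply: measurable_fun_pair; first exact: measurableT_comp mT measurable_fst.
  exact: measurable_random_transformation.
have [phi0 [[L1 gap] _]] := hphi.
have [_ [mu zmu <-] gapmu] := ereal_sup_gt gap.
have hmu : metric_entropy P T f mu != -oo%E.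
  apply: contraTneq gapmu => hmu.
  by rewrite -leNgt /free_energy hmu addNye leNye.
have hnu nu : nonzooming_measures P T f alpha delta nu ->
    metric_entropy P T f nu = -oo%E.
  move=> znu; apply/eqP/negPn/negP => hnu.
  have := free_energy_le_nonzooming mF mT L1 zmu.1 hmu znu hnu.
  by rewrite leNgt gapmu.
have lt : (ereal_sup [set metric_entropy P T f nu
             | nu in nonzooming_measures P T f alpha delta] <
   ereal_sup [set metric_entropy P T f mu
             | mu in zooming_measures P T f alpha delta])%E.
  apply: (@le_lt_trans _ _ -oo%E).
    by apply: ge_ereal_sup => _ [nu znu <-]; rewrite hnu.
  apply: (@lt_le_trans _ _ (metric_entropy P T f mu)); first by rewrite ltNye.
  by apply: ereal_sup_ubound; exists mu.
split; last exact: lt.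
split; first exact: L1_potential_cst0.
have -> : free_energy P T f (cst 0) = metric_entropy P T f.
  by apply/funext => nu; exact: free_energy_cst0.
exact: lt.
Qed.
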